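(* Assume that $\mathfrak{c}$ is a regular cardinal. Let $X$ be an uncountable Polish space and let $\Sigma=[X]^{\mathfrak{c}}$ be the family of all subsets of $X$ of cardinality $\mathfrak{c}$. Then for every function $f\colon X\to\mathbb{R}$, Player II has a winning strategy in the game $G_1(\Sigma,f)$.
   Context: $\mathfrak{c}$ denotes the cardinality of $\mathbb{R}$. The game $G_1(\Sigma,f)$, for a non-empty family $\Sigma$ of non-empty subsets of $X$ and $f\colon X\to\mathbb{R}$: Player I plays $P\in\Sigma$, Player II plays $P_0$; then at the $n$th step ($n\ge1$) Player I plays a point $x_n$ and Player II plays a set $P_n$. The rules are: $P_n\in\Sigma$ and $P_n\subseteq P$ for all $n\ge0$ (the $P_n$ need not be decreasing), and $x_{n+1}\in P_n$ for all $n\ge 0$. Player II wins if $\langle x_n\rangle$ converges in $X$ and $\lim_{n}f(x_n)=f(\lim_{n}x_n)$; otherwise Player I wins. *)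

(* Defs.v *)
From HB Require Import structures.
From mathcomp Require Import all_boot all_order all_algebra.
From mathcomp Require Import all_classical all_reals all_analysis.
From mathcomp Require Import wochoice.
Import Order.TTheory GRing.Theory Num.Theory.
Import numFieldNormedType.Exports.

Set Implicit Arguments.
Unset Strict Implicit.
Unset Printing Implicit Defensive.

Local Open Scope classical_set_scope.
Local Open Scope ring_scope.
Local Open Scope card_scope.

(* [wochoice.well_order] is about reflexive relations.  The last condition says
   that no proper initial segment of [le] has the cardinality of [T]: the order
   type of [le] is the initial ordinal of the cardinal |T|. *)
Definition initial_well_order (T : eqType) (le : rel T) : Prop :=
  wochoice.well_order le /\
  forall x : T, ~ ([set: T] #<= [set y : T | le y x /\ y <> x]).

Definition cofinal_subset (T : Type) (le : rel T) (A : set T) : Prop :=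
  forall x : T, exists2 y : T, A y & le x y.

(* The cardinal |T| is infinite and cf |T| = |T|.  Initial well-orders of [T]
   exist and are pairwise isomorphic, so it does not matter which one is used. *)
Definition regular_cardinality (T : eqType) : Prop :=
  infinite_set [set: T] /\
  exists2 le : rel T, initial_well_order le &
    forall A : set T, cofinal_subset le A -> A #= [set: T].

Definition is_metric (R : realType) (X : Type) (d : X -> X -> R) : Prop :=
  [/\ forall x y, 0 <= d x y,
      forall x y, d x y = 0 <-> x = y,
      forall x y, d x y = d y x &
      forall x y z, d x z <= d x y + d y z].

Definition metric_induces (R : realType) (X : topologicalType)
    (d : X -> X -> R) : Prop :=
  forall (x : X) (A : set X),
    nbhs x A <-> exists2 e : R, 0 < e & [set y | d x y < e] `<=` A.

Definition cauchy_seq (R : realType) (X : Type) (d : X -> X -> R)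
    (u : nat -> X) : Prop :=
  forall e : R, 0 < e ->
    exists N : nat, forall m n, (N <= m)%N -> (N <= n)%N -> d (u m) (u n) < e.

Definition separable (X : topologicalType) : Prop :=
  exists2 D : set X, countable D & dense D.

Definition polish (R : realType) (X : topologicalType) : Prop :=
  separable X /\
  exists d : X -> X -> R,
    [/\ is_metric d, metric_induces d &
        forall u : nat -> X, cauchy_seq d u -> exists l : X, u @ \oo --> l].

Definition subsets_of_card (X Y : Type) : set (set X) :=
  [set A | A #= [set: Y]].
Arguments subsets_of_card X Y : clear implicits.

(* A run of the game G_1(Sigma, f) consists of the first move [P] of Player I,
   the moves [Q 0, Q 1, ...] of Player II and the points chosen by Player I.
   The points x_1, x_2, ... are stored from index 0, so that [x n] is the point
   x_(n+1) that Player I chooses right after [Q n] has been played. *)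
Section Game.
Variables (R : realType) (X : topologicalType).
Variables (Sigma : set (set X)) (f : X -> R).

(* Player I has obeyed the rules in all moves made before [Q n]. *)
Definition playerI_legal_before (P : set X) (Q : nat -> set X) (x : nat -> X)
    (n : nat) : Prop :=
  Sigma P /\ forall k, (k < n)%N -> Q k (x k).

Definition playerII_legal_at (P : set X) (Q : nat -> set X) (n : nat) : Prop :=
  Sigma (Q n) /\ Q n `<=` P.

(* Player II is never the first to break the rules and, if both players obey
   them forever, the limit condition holds. *)
Definition playerII_wins_run (P : set X) (Q : nat -> set X) (x : nat -> X) :
    Prop :=
  (forall n, playerI_legal_before P Q x n -> playerII_legal_at P Q n) /\
  ((forall n, playerI_legal_before P Q x n) ->
   exists2 l : X, x @ \oo --> l & (f \o x) @ \oo --> f l).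

(* [s P [:: x_1; ...; x_n]] is the move P_n of Player II. *)
Definition winning_strategyII (s : set X -> seq X -> set X) : Prop :=
  forall (P : set X) (x : nat -> X),
    playerII_wins_run P (fun n => s P (mkseq x n)) x.

Definition playerII_has_winning_strategy : Prop :=
  exists s : set X -> seq X -> set X, winning_strategyII s.

End Game.

(* Main.v *)
Require Import Defs.
From mathcomp Require Import all_boot all_order all_algebra.
From mathcomp Require Import all_classical all_reals all_analysis.
From mathcomp Require Import wochoice lra.
Import Order.TTheory GRing.Theory Num.Theory.
Import numFieldNormedType.Exports.

(** Every set [P] of cardinality continuum contains a point [l] such that each
    neighbourhood of [(l, f l)] still contains continuum many points of the
    graph of [f] above [P].  Indeed the graph lives in a separable metric
    space, so it can be cut into countably many pieces of small diameter; by
    regularity, countably many pieces of smaller cardinality cannot cover [P]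
    ([regular_countable_cover]), and this remains true when the pieces of all
    the partitions of diameter [1/(n+1)] are taken together
    ([exists_condensation_point]).

    Player II fixes such an [l] once and for all when [P] is played, and plays as
    [P_n] the points [y] of [P] such that [(y, f y)] is in the same piece of
    the [n]-th partition as [(l, f l)].  These sets are legal moves whatever
    Player I does, and any choice of points in them converges to [l], with
    values of [f] converging to [f l]. *)

Local Open Scope classical_set_scope.
Local Open Scope ring_scope.
Local Open Scope card_scope.

Lemma uncountable_realType (R : realType) : ~ countable [set: R].
Proof.
move=> /countable_lebesgue_measure0.
by rewrite -set_itvNyy lebesgue_measure_itv.
Qed.

(** The elements of a set which is not cofinal have a common strict upper
    bound.  If every [A `&` B n] were small, its copy in [T] would have such a
    bound; the set of these countably many bounds is not cofinal either, and an
    element strictly above all of them is outside every [B n]. *)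
Lemma regular_countable_cover (T : pointedType) (U : Type) (A : set U)
    (B : nat -> set U) :
  regular_cardinality T -> ~ countable [set: T] -> A #= [set: T] ->
  A `<=` \bigcup_n B n -> exists n, A `&` B n #= [set: T].
Proof.
move=> [_ [le [le_wo _] reg]] uncT /card_set_bijP[g [_ g_inj g_surj]] AB.
apply: contrapT => small.
have le_total x y : le x y || le y x.
  by apply: (@wo_chainW T le predT) => // C _; exact: le_wo.
have bound (C : set T) : ~ (C #= [set: T]) -> exists x, forall y, C y -> ~~ le x y.
  move=> nC; apply: contrapT => nb; apply: nC; apply: reg => x.
  apply: contrapT => nx; apply: nb; exists x => y Cy.
  by apply/negP => xy; apply: nx; exists y.
have /choice[t tP] n : exists x, forall y, (g @` (A `&` B n)) y -> ~~ le x y.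
  apply: bound => gT; apply: small; exists n.
  rewrite -(card_eql (@inj_card_eq _ _ _ g _)) // => x y.
  rewrite !inE => -[Ax _] [Ay _].
  by apply: g_inj; rewrite inE.
have [z zP] : exists z, forall y, range t y -> ~~ le z y.
  apply: bound => tT; apply: uncT.
  rewrite -(eq_countable tT).
  exact: sub_countable (card_image_le _ _) (countableP _).
have [u Au gu] := g_surj z I.
have [n _ Bnu] := AB u Au.
have := le_total (t n) z.
rewrite (negbTE (zP (t n) _)); last by exists n.
by rewrite (negbTE (tP n z _)) //; exists u.
Qed.

(** The bad points of [P], those lying in a small fibre of some [c n], are
    covered by countably many small sets, namely these fibres. *)
Lemma exists_condensation_point (T : pointedType) (U : Type) (P : set U)
    (c : nat -> U -> nat) :
  regular_cardinality T -> ~ countable [set: T] -> P #= [set: T] ->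
  exists2 l, P l & forall n, [set y | P y /\ c n y = c n l] #= [set: T].
Proof.
move=> reg uncT PT; apply: contrapT => bad.
pose F (nk : nat * nat) := [set y | P y /\ c nk.1 y = nk.2].
(* One sequence lists the small fibres of all the [c n]; the large ones are
   replaced by the empty set, so that no [B i] is large.  The default value of
   [odflt] only repeats the fibre of index [(0, 0)]. *)
pose B i := let C := F (odflt (0, 0)%N (choice.unpickle i)) in
  if `[< C #= [set: T] >] then set0 else C.
have [x Px|i] := @regular_countable_cover T U P B reg uncT PT.
  have [n nx] : exists n, ~ (F (n, c n x) #= [set: T]).
    apply: contrapT => good; apply: bad; exists x => // n.
    by apply: contrapT => nx; apply: good; exists n.
  exists (choice.pickle (n, c n x)) => //.
  by rewrite /B choice.pickleK /=; case: asboolP.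
rewrite /B; case: asboolP => [_|nC]; last by rewrite setIidr // => y [].
by rewrite setI0 => /eq_countable T0; apply: uncT; rewrite -T0.
Qed.

Section SmallPieces.
Variables (R : realType) (X : topologicalType) (d : X -> X -> R).
Hypotheses (d_metric : is_metric d) (d_top : metric_induces d).

(** A code of [x] is the index of a point at distance less than [e / 2] in a
    countable dense set.  Fibres serve better than balls because each fibre is
    determined by any of its points. *)
Lemma separable_small_fibres (e : R) : separable X -> 0 < e ->
  exists c : X -> nat, forall x y, c x = c y -> d x y < e.
Proof.
move=> [D /countable_injP[code code_inj] D_dense] e0.
case: d_metric => _ _ dC dtri.
have near x : exists q, D q /\ d x q < e / 2.
  have xball : nbhs x [set y | d x y < e / 2].
    by apply/d_top; exists (e / 2) => //; lra.
  have [] := D_dense [set y | d x y < e / 2]°.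
  - by exists x.
  - exact: open_interior.
  by move=> q [/interior_subset xq Dq]; exists q.
have /choice[q qP] := near.
exists (code \o q) => x y /code_inj qxy.
have [[Dx xq] [Dy yq]] := (qP x, qP y).
have {}qxy : q x = q y by apply: qxy; rewrite inE.
have := dtri x (q x) y; rewrite [d (q x) y]dC {2}qxy; lra.
Qed.

Lemma real_small_fibres (f : X -> R) (e : R) : 0 < e ->
  exists c : X -> int, forall x y, c x = c y -> `|f x - f y| < e.
Proof.
move=> e0; exists (fun x => Num.floor (f x / e)) => x y fxy.
have := floor_itv (f x / e); have := floor_itv (f y / e).
rewrite -fxy intrD ler_pdivlMr // ltr_pdivrMr // ler_pdivlMr // ltr_pdivrMr //.
move=> /andP[y1 y2] /andP[x1 x2]; rewrite ltr_norml; apply/andP; split; nra.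
Qed.

(** Pairing the two codes amounts to intersecting the two partitions: the graph
    of [f] inherits the separability of both factors of the product. *)
Lemma graph_small_fibres (f : X -> R) (e : R) : separable X -> 0 < e ->
  exists c : X -> nat, forall x y, c x = c y -> d x y < e /\ `|f x - f y| < e.
Proof.
move=> sepX e0.
have [c cP] := separable_small_fibres e sepX e0.
have [c' c'P] := real_small_fibres f e e0.
exists (fun x => choice.pickle (c x, c' x)) => x y.
by move=> /(pcan_inj choice.pickleK)[/cP xy /c'P fxy].
Qed.

Lemma cvg_of_dist_lt_harmonic (x : nat -> X) (l : X) :
  (forall n, d l (x n) < n.+1%:R^-1) -> x @ \oo --> l.
Proof.
move=> xl A /d_top[e e0 eA].
have [N _ NP] := near_infty_natSinv_lt (PosNum e0).
by exists N => // n Nn; apply: eA; apply: lt_trans (xl n) (NP n Nn).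
Qed.

End SmallPieces.

Lemma cvg_of_norm_lt_harmonic (R : realType) (u : nat -> R) (l : R) :
  (forall n, `|l - u n| < n.+1%:R^-1) -> u @ \oo --> l.
Proof.
move=> ul; apply/cvgrPdist_lt => e e0.
have [N _ NP] := near_infty_natSinv_lt (PosNum e0).
by exists N => // n Nn; apply: lt_trans (ul n) (NP n Nn).
Qed.

Local Close Scope card_scope.
Local Close Scope ring_scope.

Theorem corollary6p3 (R : realType) (hc : regular_cardinality R)
    (X : topologicalType) (hX : polish R X) (hunc : ~ countable [set: X])
    (f : X -> R) :
  playerII_has_winning_strategy (subsets_of_card X R) f.
Proof.
have [sepX [d [d_metric d_top _]]] := hX.
have /choice[c cP] n : exists c : X -> nat, forall x y, c x = c y ->
    (d x y < n.+1%:R^-1 /\ `|f x - f y| < n.+1%:R^-1)%R.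
  by apply: graph_small_fibres => //; rewrite invr_gt0.
have /choice[Q QP] (P : set X) : exists Q : nat -> set X,
    subsets_of_card X R P -> exists l, forall n,
      [/\ subsets_of_card X R (Q n), Q n `<=` P &
          Q n `<=` [set y | c n l = c n y]].
  have [PR|nPR] := pselect (subsets_of_card X R P); last by exists (fun=> P).
  have [l _ lP] := exists_condensation_point R X P c hc (@uncountable_realType R) PR.
  exists (fun n => [set y | P y /\ c n y = c n l]) => _; exists l => n.
  by split; [exact: lP | move=> y [] | move=> y []].
exists (fun P xs => Q P (size xs)) => P x; split=> [n [PR _]|legal].
  by rewrite /playerII_legal_at size_mkseq; have [l /(_ n)[]] := QP P PR.
have [PR _] := legal 0.
have [l lP] := QP P PR.
have close n : (d l (x n) < n.+1%:R^-1 /\ `|f l - f (x n)| < n.+1%:R^-1)%R.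
  have [_ /(_ n (ltnSn n))] := legal n.+1; rewrite /= size_mkseq => Qx.
  by have [_ _ /(_ _ Qx)/cP] := lP n.
exists l.
  by apply: (cvg_of_dist_lt_harmonic R X d d_top) => n; have [] := close n.
by apply: cvg_of_norm_lt_harmonic => n; have [] := close n.
Qed.
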